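(* Let $a<b$, let $J\subseteq\mathbb{R}$ with $[0,1]\subseteq J$, let $h:J\to\mathbb{R}$ be a nonnegative function, and let $f:[a,b]\to(0,\infty)$ be an $h$-logarithmically convex function on $[a,b]$. Then for all $\alpha,\beta>0$ with $\alpha+\beta=1$, $$f\left(\frac{a+b}{2}\right)\le \alpha\,\frac{1}{b-a}\int_a^b f(x)^{\frac{h(1/2)}{\alpha}}dx+\beta\,\frac{1}{b-a}\int_a^b f(x)^{\frac{h(1/2)}{\beta}}dx.$$
   Context: A positive function $f$ on a real interval $I=[a,b]$ is called $h$-logarithmically convex ($h$-$\log$-convex) if for all $x,y\in I$ and $t\in[0,1]$, $f(tx+(1-t)y)\le [f(x)]^{h(t)}[f(y)]^{h(1-t)}$, where $h:J\to\mathbb{R}$ is a nonnegative function on $J\subseteq\mathbb{R}$. *)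

(* Defs.v *)
From mathcomp Require Import all_boot all_order all_algebra.
From mathcomp Require Import all_classical all_reals all_analysis.

Set Implicit Arguments.
Unset Strict Implicit.
Unset Printing Implicit Defensive.

Import Order.TTheory GRing.Theory Num.Theory.
Import numFieldNormedType.Exports.

Local Open Scope classical_set_scope.
Local Open Scope ring_scope.

(* Functions are total: only the values of [h] on [0, 1] and those of [f] on
   [a, b] matter. *)
Definition h_log_convex (R : realType) (h : R -> R) (a b : R) (f : R -> R) :
    Prop :=
  (forall x, x \in `[a, b] -> 0 < f x) /\
  (forall x y t, x \in `[a, b] -> y \in `[a, b] -> t \in `[0, 1] ->
     f (t * x + (1 - t) * y) <= f x `^ h t * f y `^ h (1 - t)).

(* [R] with the Lebesgue-measurable sets, i.e. the domain of
   [completed_lebesgue_measure]. The canonical sigma-algebra of [R] is only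
   the Borel one, for which, e.g., a Riemann-integrable function need not be
   measurable. *)
Notation lebesgueType R :=
  (caratheodory_type ((@wlength R idfun)^*)%mu) (only parsing).

(* Main.v *)
(* Taking t = 1/2 at the points x and a + b - x, Young's inequality with
   exponents 1/alpha and 1/beta gives
     f((a + b)/2) <= alpha f(x)^(h(1/2)/alpha) + beta f(a + b - x)^(h(1/2)/beta);
   average over x in [a, b]. The integrands being only Lebesgue measurable, the
   change of variable x |-> a + b - x is justified on the Lebesgue outer
   measure itself: a cover by half-open intervals reflects to a cover by
   intervals of the same lengths. *)
Require Import Defs.
From mathcomp Require Import all_boot all_order all_algebra.
From mathcomp Require Import all_classical all_reals all_analysis.
From mathcomp Require Import measurable_realfun ring lra.

Set Implicit Arguments.
Unset Strict Implicit.
Unset Printing Implicit Defensive.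

Import Order.TTheory GRing.Theory Num.Theory.
Import numFieldNormedType.Exports.

Local Open Scope classical_set_scope.
Local Open Scope ring_scope.

Section Reflection.
Context {R : realType}.
Local Open Scope ereal_scope.

Notation mu_out := ((@wlength R idfun)^*)%mu.

Variable c : R.
Let refl (x : lebesgueType R) : lebesgueType R := (c - x)%R.

Let refl_itv (x y : R) :
  refl @^-1` `]x, y]%classic = `[(c - y)%R, (c - x)%R[%classic.
Proof.
apply/seteqP; split; move=> z /=; rewrite /refl !in_itv/= => /andP[? ?];
  by apply/andP; split; lra.
Qed.

(** Reflection moves the closed end to the left, so the image is no longer one of the generating
    intervals; its outer measure is read off from the Lebesgue measure of intervals. For [y <= x]
    both sides vanish. *)
Let wlength_refl (A : set R) : @ocitv R A ->
  mu_out (refl @^-1` A) = @wlength R idfun A.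
Proof.
move=> [[x y] _ <-] /=; rewrite refl_itv wlength_itv/=.
rewrite [LHS](lebesgue_measure_itv `[(c - y)%R, (c - x)%R[)/= !lte_fin.
rewrite ltrD2l ltrN2.
by case: ifPn => // _; rewrite -!EFinB; congr _%:E; ring.
Qed.

(** Any countable cover of [A] by half-open intervals pulls back to a cover of the reflected set;
    subadditivity bounds the outer measure of the latter by the same sum of lengths, and the infimum
    over covers concludes. *)
Let le_mu_out_refl (A : set R) : mu_out (refl @^-1` A) <= mu_out A.
Proof.
apply: le_ereal_inf_tmp => _ [F [mF AF] <-].
have AFr : refl @^-1` A `<=` \bigcup_k (refl @^-1` F k).
  by move=> x /AF[k _ Fk]; exists k.
apply: le_trans (le_outer_measure mu_out _ _ AFr) _.
apply: le_trans (outer_measure_sigma_subadditive mu_out _) _.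
apply: lee_nneseries => k _.
  by move=> _; exact: (outer_measure_ge0 mu_out).
suff : mu_out (refl @^-1` F k) <= wlength idfun (F k) by [].
by rewrite (wlength_refl (mF k)).
Qed.

Let reflK : involutive refl.
Proof. by move=> x; rewrite /refl subKr. Qed.

(** The reflection is an involution, so the inequality applied to the reflected set gives the
    converse one. *)
Lemma lebesgue_outer_measure_reflection (A : set R) :
  mu_out ((fun x => c - x)%R @^-1` A) = mu_out A.
Proof.
apply/eqP; rewrite eq_le le_mu_out_refl/=.
apply: le_trans (le_mu_out_refl (refl @^-1` A)).
apply: le_outer_measure => x Ax /=; rewrite -/(refl _).
by rewrite reflK.
Qed.

Lemma lebesgue_measurable_reflection : measurable_fun setT refl.
Proof.
move=> _ A mA; rewrite setTI.
have {}mA : caratheodory_measurable mu_out A by [].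
suff : caratheodory_measurable mu_out (refl @^-1` A) by [].
move=> X.
(* Cutting [X] by a reflected set amounts to cutting the reflected [X] by the original set, so the
   Caratheodory criterion for [A] can be tested on the reflected [X]. *)
have XE B : X `&` refl @^-1` B = refl @^-1` (refl @^-1` X `&` B).
  by apply/seteqP; split => x /=; rewrite reflK.
rewrite -lebesgue_outer_measure_reflection (mA _) XE [in RHS](XE (~` A)).
by rewrite !lebesgue_outer_measure_reflection.
Qed.

(** Change of variables through the pushforward measure, which coincides with the completed Lebesgue
    measure because the outer measure is invariant. *)
Lemma ge0_integral_reflection (D : set R) (g : R -> \bar R) :
  measurable (D : set (lebesgueType R)) ->
  measurable_fun (D : set (lebesgueType R)) (fun x : lebesgueType R => g x) ->
  (forall x, D x -> 0 <= g x) ->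
  \int[@completed_lebesgue_measure R]_(x in refl @^-1` D) g (c - x)%R =
  \int[@completed_lebesgue_measure R]_(x in D) g x.
Proof.
move=> mD mg g0.
transitivity
    (\int[pushforward (@completed_lebesgue_measure R) refl]_(x in D) g x).
  rewrite (ge0_integral_pushforward lebesgue_measurable_reflection)//.
  by move=> x; rewrite inE; exact: g0.
apply: eq_measure_integral; first exact: lebesgue_measurable_reflection.
move=> mr A mA _.
exact: (lebesgue_outer_measure_reflection A).
Qed.

End Reflection.

Section CompletedItv.
Context {R : realType}.

Lemma lebesgue_measurable_itv (i : interval R) :
  measurable ([set` i] : set (lebesgueType R)).
Proof. exact: sub_caratheodory (measurable_itv i). Qed.

Lemma completed_lebesgue_measure_itv (i : interval R) :
  @completed_lebesgue_measure R [set` i] =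
  (if (i.1 : \bar R) < i.2 then (i.2 : \bar R) - i.1 else 0)%E.
Proof. exact: lebesgue_measure_itv. Qed.

End CompletedItv.

Lemma h_log_convex_midpoint (R : realType) (a b : R) (h f : R -> R)
    (alpha beta x y : R) :
  h_log_convex h a b f -> 0 < alpha -> 0 < beta -> alpha + beta = 1 ->
  x \in `[a, b] -> y \in `[a, b] ->
  f ((x + y) / 2) <= alpha * f x `^ (h 2^-1 / alpha) +
                     beta * f y `^ (h 2^-1 / beta).
Proof.
move=> [f_gt0 fh] alpha0 beta0 ab1 xab yab.
have h2 : 2^-1 \in `[0 : R, 1] by rewrite in_itv/=; apply/andP; split; lra.
have := fh _ _ _ xab yab h2.
have -> : 1 - 2^-1 = 2^-1 :> R by lra.
have -> : 2^-1 * x + 2^-1 * y = (x + y) / 2 by lra.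
move=> /le_trans; apply.
(* Young's inequality: the exponents [alpha^-1] and [beta^-1] are conjugate because
   [alpha + beta = 1]. *)
have := @conjugate_powR R (f x `^ h 2^-1) (f y `^ h 2^-1) alpha^-1 beta^-1.
rewrite !invrK -!powRrM !(mulrC _ alpha) !(mulrC _ beta).
by apply; rewrite ?powR_ge0 ?invr_gt0.
Qed.

(** Monotonicity and linearity of the integral, the left side being the integral of the constant.
    Nonnegativity replaces integrability, so infinite integrals are allowed. *)
Lemma cst_le_ge0_integral_combination d (T : measurableType d) (R : realType)
    (mu : {measure set T -> \bar R}) (D : set T) (F G : T -> \bar R)
    (c k l : R) :
  measurable D -> measurable_fun D F -> measurable_fun D G ->
  (forall x, 0 <= F x)%E -> (forall x, 0 <= G x)%E ->
  0 <= c -> 0 <= k -> 0 <= l ->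
  (forall x, D x -> c%:E <= k%:E * F x + l%:E * G x)%E ->
  (c%:E * mu D <=
     k%:E * \int[mu]_(x in D) F x + l%:E * \int[mu]_(x in D) G x)%E.
Proof.
move=> mD mF mG F0 G0 c0 k0 l0 cFG.
rewrite -!ge0_integralZl_EFin// -ge0_integralD//; last 4 first.
- by move=> x _; rewrite mule_ge0.
- exact: measurable_funeM.
- by move=> x _; rewrite mule_ge0.
- exact: measurable_funeM.
rewrite -integral_cst//; apply: ge0_le_integral => //.
by apply: emeasurable_funD; exact: measurable_funeM.
Qed.

Theorem theorem4 (R : realType) (a b : R) (J : set R) (h f : R -> R)
    (hab : a < b)
    (hJ : `[0, 1]%classic `<=` J)
    (h_ge0 : forall t, J t -> 0 <= h t)
    (hf : h_log_convex h a b f)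
    (alpha beta : R) (halpha : 0 < alpha) (hbeta : 0 < beta)
    (hsum : alpha + beta = 1)
    (malpha : measurable_fun (`[a, b]%classic : set (lebesgueType R))
       (fun x : lebesgueType R => f x `^ (h 2^-1 / alpha)))
    (mbeta : measurable_fun (`[a, b]%classic : set (lebesgueType R))
       (fun x : lebesgueType R => f x `^ (h 2^-1 / beta))) :
  ((f ((a + b) / 2))%:E <=
     alpha%:E * ((b - a)^-1%:E *
       \int[@completed_lebesgue_measure R]_(x in `[a, b]%classic)
         (f x `^ (h 2^-1 / alpha))%:E)
   + beta%:E * ((b - a)^-1%:E *
       \int[@completed_lebesgue_measure R]_(x in `[a, b]%classic)
         (f x `^ (h 2^-1 / beta))%:E))%E.
Proof.
set mu := @completed_lebesgue_measure R.
set D := `[a, b]%classic : set (lebesgueType R).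
set F := fun x : lebesgueType R => (f x `^ (h 2^-1 / alpha))%:E.
set G := fun x : lebesgueType R => (f x `^ (h 2^-1 / beta))%:E.
have mD : measurable D by exact: lebesgue_measurable_itv.
have mF : measurable_fun D F by exact/measurable_EFinP.
have mG : measurable_fun D G by exact/measurable_EFinP.
have F0 x : (0 <= F x)%E by rewrite lee_fin powR_ge0.
have G0 x : (0 <= G x)%E by rewrite lee_fin powR_ge0.
have DE : (fun x : lebesgueType R => a + b - x : lebesgueType R) @^-1` D = D.
  apply/seteqP; split; move=> z; rewrite /D /= !in_itv/= => /andP[? ?];
    by apply/andP; split; lra.
have mGr : measurable_fun D (fun x => G (a + b - x)).
  have mr := measurable_funS measurableT (@subsetT _ D)
    (lebesgue_measurable_reflection (a + b)).
  apply: (measurable_comp mD _ mG mr).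
  by move=> _ [x Dx <-]; rewrite -DE in Dx.
have intG : (\int[mu]_(x in D) G (a + b - x)%R = \int[mu]_(x in D) G x)%E.
  by rewrite -[in RHS](ge0_integral_reflection (a + b))// DE.
have ba0 : 0 < b - a by rewrite subr_gt0.
(* The averaged inequality multiplied by [b - a]; the reflection has already been removed from the
   second integral by [intG]. *)
have le_int : ((f ((a + b) / 2))%:E * (b - a)%:E <=
    alpha%:E * \int[mu]_(x in D) F x + beta%:E * \int[mu]_(x in D) G x)%E.
  have <- : (mu D = (b - a)%:E)%E.
    by rewrite [mu D]completed_lebesgue_measure_itv/= lte_fin hab -EFinB.
  rewrite -intG; apply: cst_le_ge0_integral_combination => //; try exact: ltW.
    by apply/ltW/hf.1; rewrite in_itv/=; apply/andP; split; lra.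
  move=> x Dx; rewrite -!EFinM -EFinD lee_fin.
  (* The midpoint of [x] and its mirror image is always the centre of [[a, b]]. *)
  have -> : (a + b) / 2 = (x + (a + b - x)) / 2 by lra.
  apply: (h_log_convex_midpoint hf) => //.
  by rewrite -DE in Dx.
have IF0 : (0 <= \int[mu]_(x in D) F x)%E.
  by apply: integral_ge0 => x _; exact: F0.
have IG0 : (0 <= \int[mu]_(x in D) G x)%E.
  by apply: integral_ge0 => x _; exact: G0.
move: le_int IF0 IG0.
move: (integral _ _ F) (integral _ _ G) => IF IG le_int IF0 IG0.
(* The integrals may be [+oo], so factoring out [(b - a)^-1] relies on both terms being
   nonnegative. *)
rewrite !(muleCA _ (b - a)^-1%:E) -ge0_muleDr; last 2 first.
- by rewrite mule_ge0// lee_fin ltW.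
- by rewrite mule_ge0// lee_fin ltW.
by rewrite muleC lee_pdivlMr.
Qed.
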